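(* Let $n\ge 1$, $0<m\le L$, $\kappa=L/m$, and let $(\alpha,\beta,\gamma)$ be constant parameters such that the two-step momentum algorithm converges linearly with rate $\rho=1-1/T_s\in(0,1)$ for all $f\in\mathcal{Q}_m^L$. Then for every $f\in\mathcal{Q}_m^L$ the noise amplification satisfies $$J\;\le\;\frac{\sigma_w^2(1+\rho^2)}{(1+\rho)^3}\,n\,T_s^3 .$$ Furthermore, for the gradient noise model ($\sigma_w=\alpha\sigma$), $$J\;\le\;\frac{\sigma^2(1+\rho)(1+\rho^2)}{L^2}\,n\,T_s^3 .$$
   Context: $\mathcal{Q}_m^L$ is the class of quadratic functions $f(x)=\tfrac12x^TQx-q^Tx$ on $\mathbb{R}^n$ with $q\in\mathbb{R}^n$, $Q=Q^T\succ0$ whose largest eigenvalue is $L$ and smallest is $m$; $x^\star$ is the minimizer. The noisy two-step momentum algorithm with constant parameters $(\alpha,\beta,\gamma)$ is $x^{t+2}=x^{t+1}+\beta(x^{t+1}-x^t)-\alpha\nabla f\big(x^{t+1}+\gamma(x^{t+1}-x^t)\big)+\sigma_w w^t$, where $w^t$ is white noise with $\mathbb{E}[w^t]=0$, $\mathbb{E}[w^t(w^\tau)^T]=I\,\delta(t-\tau)$ ($\delta$ the Kronecker delta). In the iterate noise model $\sigma_w=\sigma$, in the gradient noise model $\sigma_w=\alpha\sigma$, with $\sigma>0$. With $\psi^t=[(x^t-x^\star)^T,(x^{t+1}-x^\star)^T]^T$ one has $\psi^{t+1}=A\psi^t+Bw^t$, $A=\begin{bmatrix}0&I\\-\beta I+\gamma\alpha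 Q&(1+\beta)I-(1+\gamma)\alpha Q\end{bmatrix}$, $B^T=[0\;\;\sigma_wI]$. The algorithm converges linearly with rate $\rho$ for all $f\in\mathcal{Q}_m^L$ if the spectral radius of $A$ is at most $\rho$ for every $f\in\mathcal{Q}_m^L$ (the spectral radius of $A$ is the best achievable linear rate in the noiseless case). The settling time is $T_s=1/(1-\rho)$. The noise amplification is $J=\lim_{t\to\infty}\frac1t\sum_{k=0}^t\mathbb{E}\|x^k-x^\star\|_2^2$. *)

(* Defs.v *)
From mathcomp Require Import all_boot all_order all_algebra.
From mathcomp Require Import all_classical all_reals all_analysis.
From mathcomp Require Import complex.
Set Implicit Arguments. Unset Strict Implicit. Unset Printing Implicit Defensive.
Import Order.TTheory GRing.Theory Num.Theory.
Local Open Scope ring_scope.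

Section Defs.
Variables (R : realType) (n : nat).

Definition quadf (Q : 'M[R]_n) (q x : 'cV[R]_n) : R :=
  2^-1 * (x^T *m Q *m x) 0 0 - (q^T *m x) 0 0.

Definition quadgrad (Q : 'M[R]_n) (q y : 'cV[R]_n) : 'cV[R]_n := Q *m y - q.

Definition is_minimizer (Q : 'M[R]_n) (q xs : 'cV[R]_n) : Prop :=
  forall y, quadf Q q xs <= quadf Q q y.

Definition posdef (Q : 'M[R]_n) : Prop :=
  forall x : 'cV[R]_n, x != 0 -> 0 < (x^T *m Q *m x) 0 0.

Definition in_QmL (m L : R) (Q : 'M[R]_n) : Prop :=
  [/\ Q^T = Q, posdef Q, eigenvalue Q L, eigenvalue Q m &
      forall a, eigenvalue Q a -> m <= a <= L].

Definition momA (alpha beta gamma : R) (Q : 'M[R]_n) : 'M[R]_(n + n) :=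
  block_mx 0 1%:M
           (gamma * alpha *: Q - beta%:M)
           ((1 + beta)%:M - (1 + gamma) * alpha *: Q).

Definition spectral_radius_le (k : nat) (A : 'M[R]_k) (rho : R) : Prop :=
  forall z : R[i], root (map_poly (real_complex R) (char_poly A)) z ->
    `|z| <= real_complex R rho.

Definition converges_linearly (m L alpha beta gamma rho : R) : Prop :=
  forall Q : 'M[R]_n, in_QmL m L Q ->
    spectral_radius_le (momA alpha beta gamma Q) rho.

Definition mom_step (alpha beta gamma sw : R) (Q : 'M[R]_n) (q : 'cV[R]_n)
  (xt xt1 wt : 'cV[R]_n) : 'cV[R]_n :=
  xt1 + beta *: (xt1 - xt)
      - alpha *: quadgrad Q q (xt1 + gamma *: (xt1 - xt)) + sw *: wt.

Fixpoint mom_pair (alpha beta gamma sw : R) (Q : 'M[R]_n) (q : 'cV[R]_n)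
  (x0 x1 : 'cV[R]_n) (wv : nat -> 'cV[R]_n) (t : nat) : 'cV[R]_n * 'cV[R]_n :=
  match t with
  | 0 => (x0, x1)
  | t'.+1 => let p := mom_pair alpha beta gamma sw Q q x0 x1 wv t' in
             (p.2, mom_step alpha beta gamma sw Q q p.1 p.2 (wv t'))
  end.

Definition mom_iter alpha beta gamma sw Q q x0 x1 wv t : 'cV[R]_n :=
  (mom_pair alpha beta gamma sw Q q x0 x1 wv t).1.

Definition sqnorm (v : 'cV[R]_n) : R := \sum_i (v i 0) ^+ 2.

End Defs.

Section Noise.
Local Open Scope ereal_scope.
Context {d : measure_display} {Omega : measurableType d} {R : realType}.

Definition white_noise (P : probability Omega R) (n : nat)
  (w : nat -> 'I_n -> {RV P >-> R}) : Prop :=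
  (forall t i, 'E_P[w t i] = 0) /\
  (forall t s i j, 'E_P[fun om => (w t i om * w s j om)%R] =
                   (if (t == s) && (i == j) then 1%R else 0%R)%:E).

Definition noise_vec (P : probability Omega R) (n : nat)
  (w : nat -> 'I_n -> {RV P >-> R}) (om : Omega) (t : nat) : 'cV[R]_n :=
  \col_i w t i om.

Definition mean_sq_err (P : probability Omega R) (n : nat)
  (w : nat -> 'I_n -> {RV P >-> R})
  (alpha beta gamma sw : R) (Q : 'M[R]_n) (q x0 x1 xs : 'cV[R]_n) (k : nat)
  : \bar R :=
  'E_P[fun om => sqnorm (mom_iter alpha beta gamma sw Q q x0 x1
                            (noise_vec w om) k - xs)].

Definition cesaro_msq (P : probability Omega R) (n : nat)
  (w : nat -> 'I_n -> {RV P >-> R})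
  (alpha beta gamma sw : R) (Q : 'M[R]_n) (q x0 x1 xs : 'cV[R]_n) (t : nat)
  : \bar R :=
  ((t%:R)^-1)%:E * \sum_(k < t.+1) mean_sq_err w alpha beta gamma sw Q q x0 x1 xs k.

End Noise.

(* Main.v *)
Require Import Defs.
From mathcomp Require Import all_boot all_order all_algebra.
From mathcomp Require Import all_classical all_reals all_analysis.
From mathcomp Require Import complex spectral sesquilinear measurable_realfun.
From mathcomp Require Import ring lra.
Set Implicit Arguments. Unset Strict Implicit. Unset Printing Implicit Defensive.
Import Order.TTheory GRing.Theory Num.Theory.
Import numFieldNormedType.Exports.
Local Open Scope classical_set_scope.
Local Open Scope ring_scope.

(** The error e_t = x^t - x* obeys e_{t+2} = N e_{t+1} + M e_t + sw w^t with M
    and N affine in Q.  If H_t is the impulse response of this recursion, then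
    white noise gives E|e_k|^2 = |u_k|^2 + sw^2 \sum_(t < k) \tr (H_t^2), where
    u_k is the noiseless error.  Diagonalizing Q splits the trace into scalar
    recursions, one for each eigenvalue lam, with characteristic polynomial
    z^2 + b z + a, where a = beta - gamma alpha lam and
    b = (1 + gamma) alpha lam - (1 + beta).  A Lyapunov function shows that the
    squared impulse response of such a recursion sums to
    (1 + a) / ((1 - a) ((1 + a)^2 - b^2)).  Both roots lie in the disk of radius
    rho, that is |a| <= rho^2 and rho |b| <= rho^2 + a, and this sum is then
    largest at the double root +-rho.  In the gradient noise model,
    alpha L = 1 + a + b <= (1 + rho)^2 bounds the step size. *)

(** * Root location of a real quadratic and the bound on its variance *)

Section Quadratic.
Variable R : realType.
Implicit Types a b rho : R.

(** Stability triangle of the disk of radius [rho]. Real roots lie in [[-rho, rho]], which bounds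
    their product and sum; for a conjugate pair, [a] is the squared modulus. *)
Lemma quadratic_roots_disk a b rho : 0 < rho ->
  (forall z : R[i], z ^+ 2 + real_complex R b * z + real_complex R a = 0 ->
     `|z| <= real_complex R rho) ->
  [/\ - rho ^+ 2 <= a, a <= rho ^+ 2 & `|b| * rho <= rho ^+ 2 + a].
Proof.
move=> rho0 h; have [dge|dlt] := leP 0 (b ^+ 2 - 4 * a).
  set s := Num.sqrt (b ^+ 2 - 4 * a).
  have s2 : s ^+ 2 = b ^+ 2 - 4 * a by rewrite sqr_sqrtr.
  have real_root r : r ^+ 2 + b * r + a = 0 -> - rho <= r <= rho.
    move=> r0; have := h (real_complex R r).
    rewrite -rmorphXn -!rmorphM -!rmorphD r0 rmorph0 => /(_ erefl).
    by rewrite normc_def/= expr0n/= addr0 sqrtr_sqr lecR ler_norml.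
  have r1 : - rho <= (- b + s) / 2 <= rho by apply: real_root; lra.
  have r2 : - rho <= (- b - s) / 2 <= rho by apply: real_root; lra.
  have aE : a = ((- b + s) / 2) * ((- b - s) / 2) by lra.
  have bE : b = - ((- b + s) / 2 + (- b - s) / 2) by lra.
  move: r1 r2 aE bE; set r := (- b + s) / 2; set t := (- b - s) / 2.
  move=> /andP[r1 r2] /andP[t1 t2] -> ->.
  have norm_bound : `|- (r + t)| <= rho + r * t / rho.
    rewrite ler_norml; apply/andP; split.
      rewrite -subr_ge0 [leRHS](_ : _ = (rho - r) * (rho - t) / rho).
        by apply: divr_ge0 (ltW rho0); apply: mulr_ge0; lra.
      by field; rewrite gt_eqF.
    rewrite -subr_ge0 [leRHS](_ : _ = (rho + r) * (rho + t) / rho).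
      by apply: divr_ge0 (ltW rho0); apply: mulr_ge0; lra.
    by field; rewrite gt_eqF.
  split; [nra|nra|].
  have -> : rho ^+ 2 + r * t = (rho + r * t / rho) * rho.
    by field; rewrite gt_eqF.
  by rewrite ler_pM2r.
have a_le : a <= rho ^+ 2.
  set s := Num.sqrt (4 * a - b ^+ 2).
  have s2 : s ^+ 2 = 4 * a - b ^+ 2 by rewrite sqr_sqrtr//; lra.
  have := h (Complex (- b / 2) (s / 2)).
  have -> : Complex (- b / 2) (s / 2) ^+ 2 + real_complex R b *
      Complex (- b / 2) (s / 2) + real_complex R a = 0.
    rewrite expr2; apply/eqP; rewrite eq_complex/=; apply/andP; split; apply/eqP.
      by lra.
    by lra.
  move=> /(_ erefl); rewrite normc_def/= lecR => sq_le.
  have -> : a = Num.sqrt ((- b / 2) ^+ 2 + (s / 2) ^+ 2) ^+ 2.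
    rewrite sqr_sqrtr; last by rewrite addr_ge0 ?sqr_ge0.
    by lra.
  by rewrite ler_sqr ?nnegrE ?sqrtr_ge0// ltW.
have a0 : 0 < a by have := sqr_ge0 b; lra.
split=> //; first by have := sqr_ge0 rho; lra.
(* Squares are compared: [b ^+ 2 < 4 * a], and [(rho ^+ 2 + a) ^+ 2 - 4 * a * rho ^+ 2] is the
   square of [rho ^+ 2 - a]. *)
rewrite -ler_sqr ?nnegrE; last 2 first.
- by rewrite mulr_ge0// ltW.
- by rewrite addr_ge0 ?sqr_ge0// ltW.
rewrite exprMn real_normK ?num_real//.
have : 0 <= rho ^+ 2 * (4 * a - b ^+ 2) by rewrite mulr_ge0 ?sqr_ge0//; lra.
have := sqr_ge0 (rho ^+ 2 - a); lra.
Qed.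

(** Stationary variance of the autoregression [y_{t+2} = - b y_{t+1} - a y_t] driven by unit white
    noise. *)
Definition ar2_variance a b := (1 + a) / ((1 - a) * ((1 + a) ^+ 2 - b ^+ 2)).

(** The triangle for radius [rho] lies inside the open Jury triangle, the stability region of the
    scalar recursion, because [a <= rho ^+ 2 < rho]. *)
Lemma disk_jury a b rho : 0 < rho < 1 ->
  [/\ - rho ^+ 2 <= a, a <= rho ^+ 2 & `|b| * rho <= rho ^+ 2 + a] ->
  `|a| < 1 /\ `|b| < 1 + a.
Proof.
move=> /andP[r0 r1] [a1 a2 hb].
have rr : rho ^+ 2 < rho by rewrite expr2 gtr_pMr.
split; first by rewrite ltr_norml; apply/andP; split; lra.
rewrite -(ltr_pM2r r0); apply: le_lt_trans hb _.
rewrite -subr_gt0 [ltRHS](_ : _ = (1 - rho) * (rho - a)); last by ring.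
by rewrite mulr_gt0//; lra.
Qed.

(** The factor [(1 + a) / (1 - a)], increasing in [a], and the inverse of [(1 + a) ^+ 2 - b ^+ 2]
    are bounded separately; both bounds are attained at [a = rho ^+ 2], [|b| = 2 * rho]. *)
Lemma ar2_variance_le a b rho : 0 < rho < 1 ->
  [/\ - rho ^+ 2 <= a, a <= rho ^+ 2 & `|b| * rho <= rho ^+ 2 + a] ->
  ar2_variance a b <= (1 + rho ^+ 2) / (1 - rho ^+ 2) ^+ 3.
Proof.
move=> hr hab; have [a1 _] := disk_jury hr hab.
move: hr hab => /andP[r0 r1] [al au hb].
move: a1; rewrite ltr_norml => /andP[a1 a2].
have rr : rho ^+ 2 < 1 by rewrite expr_lt1// ltW.
(* Multiplied by [rho ^+ 2], with [|b| * rho] at its maximum, the gap is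
   [(1 - rho ^+ 2) * (rho ^+ 4 - a ^+ 2)]. *)
have key : (1 - rho ^+ 2) ^+ 2 <= (1 + a) ^+ 2 - b ^+ 2.
  have r2 : 0 < rho ^+ 2 by rewrite exprn_gt0.
  rewrite -(ler_pM2r r2).
  have : (`|b| * rho) ^+ 2 <= (rho ^+ 2 + a) ^+ 2.
    by rewrite ler_sqr ?nnegrE// ?(mulr_ge0 _ (ltW r0))//; lra.
  rewrite exprMn real_normK ?num_real// => hb2.
  have a_sq : 0 <= (rho ^+ 2 - a) * (rho ^+ 2 + a) by rewrite mulr_ge0//; lra.
  have : 0 <= (1 - rho ^+ 2) * ((rho ^+ 2 - a) * (rho ^+ 2 + a)).
    by rewrite mulr_ge0//; lra.
  lra.
have d0 : 0 < (1 - rho ^+ 2) ^+ 2 by rewrite exprn_gt0//; lra.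
rewrite /ar2_variance invfM mulrA exprS invfM mulrA.
apply: ler_pM.
- by rewrite divr_ge0//; lra.
- by rewrite invr_ge0 (le_trans (ltW d0)).
- rewrite ler_pdivrMr; last lra.
  by rewrite mulrAC ler_pdivlMr; [nra|lra].
- by rewrite lef_pV2// posrE (lt_le_trans d0).
Qed.

End Quadratic.

(** Taken over a ring so that matrices and the scalars of each eigenvalue share one definition. The
    leading 0 is the second initial value that the recursion needs. *)
Fixpoint impulse (A : pzRingType) (c d : A) (t : nat) : A :=
  if t is t1.+1 then
    if t1 is t2.+1 then c * impulse c d t1 + d * impulse c d t2 else 1
  else 0.

Lemma impulseSS (A : pzRingType) (c d : A) t :
  impulse c d t.+2 = c * impulse c d t.+1 + d * impulse c d t.
Proof. by []. Qed.

(** * Limits of sequences and Cesaro means *)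

Lemma sqr_cvg0 (R : realType) (u : R^nat) :
  (fun k => u k ^+ 2) @ \oo --> (0 : R) -> u @ \oo --> (0 : R).
Proof.
move=> /cvgrPdist_lt u0; apply/cvgrPdist_lt => e e0.
have := u0 (e ^+ 2) (exprn_gt0 2 e0); apply: filterS => k.
rewrite !sub0r !normrN normrX => h.
by rewrite -ltr_sqr ?nnegrE// ltW.
Qed.

(** The sum has [t + 1] terms but is divided by [t]; the ratio [1 + 1 / t] to the usual mean tends
    to 1. *)
Lemma cesaro_shift (R : realType) (u : R^nat) (l : R) : u @ \oo --> l ->
  (fun t => t%:R^-1 * \sum_(k < t.+1) u k) @ \oo --> l.
Proof.
move=> /cesaro ul.
have ratio : (fun t => 1 + t%:R^-1 : R) @ \oo --> (1 : R).
  rewrite -[X in _ --> X]addr0; apply: cvgD; first exact: cvg_cst.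
  by rewrite -(cvg_shiftS (fun t => t%:R^-1 : R)); have := @cvg_harmonic R; apply.
have lim : (fun t => (1 + t%:R^-1) * arithmetic_mean u t) @ \oo --> l.
  by rewrite -[X in _ --> X]mul1r; exact: cvgM.
apply: cvg_trans lim.
(* At [t = 0] the inverse is 0 and the two sides may differ, so they are only eventually equal. *)
apply: near_eq_cvg; near=> t; have t0 : (0 < t)%N by near: t; exists 1%N.
rewrite /arithmetic_mean/= seriesEord/=.
rewrite mulrA; congr (_ * _); rewrite -[t.+1]addn1 natrD; field.
by rewrite natr1 !pnatr_eq0 -lt0n t0.
Unshelve. all: by end_near. Qed.

Lemma cvg_ord_sum (R : realType) (n : nat) (f : 'I_n -> R^nat) (l : 'I_n -> R) :
  (forall i, f i @ \oo --> l i) ->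
  (fun t => \sum_i f i t) @ \oo --> \sum_i l i.
Proof.
by move=> fl; apply: cvg_big => [|i _]; [exact: add_continuous|exact: fl].
Qed.

Lemma cvg_ord_sum0 (R : realType) (n : nat) (f : 'I_n -> R^nat) :
  (forall i, f i @ \oo --> (0 : R)) -> (fun t => \sum_i f i t) @ \oo --> (0 : R).
Proof.
by move=> f0; have := cvg_ord_sum f0; rewrite big1.
Qed.

(** * Square summability of the stable scalar response *)

Section Ar2.
Variables (R : realType) (a b : R).
Hypotheses (a1 : `|a| < 1) (ba : `|b| < 1 + a).

Let p := impulse (- b) (- a).
Let C := ar2_variance a b.

Lemma jury_gt0 : 0 < (1 + a) ^+ 2 - b ^+ 2.
Proof.
rewrite subr_gt0 -[ltLHS]real_normK ?num_real// ltr_sqr ?nnegrE//.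
by rewrite ltW// (le_lt_trans _ ba).
Qed.

Lemma ar2_variance_gt0 : 0 < C.
Proof.
move: a1; rewrite ltr_norml => /andP[? ?].
by rewrite divr_gt0 ?mulr_gt0 ?jury_gt0//; lra.
Qed.

(* The Lyapunov function of the recursion: it decreases by exactly the square
   of the current output. *)
Let V k := p k ^+ 2 + C * ((a * p k) ^+ 2
  + 2 * (a * p k) * p k.+1 * (b / (1 + a)) + p k.+1 ^+ 2).

(** The initial values 0 and 1 give [V 0 = C]; the decrease of [V] then telescopes. *)
Let sumV k : \sum_(j < k) p j ^+ 2 = C - V k.
Proof.
move: a1; rewrite ltr_norml => /andP[a2 a3].
elim: k => [|k IH].
  by rewrite big_ord0 /V /p/=; ring.
rewrite big_ord_recr/= IH /V /p impulseSS -/p.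
have d1 : 1 - a != 0 by rewrite gt_eqF//; lra.
have d2 : 1 + a != 0 by rewrite gt_eqF//; lra.
have d3 : (1 + a) ^+ 2 - b ^+ 2 != 0 by rewrite gt_eqF// jury_gt0.
by rewrite /C /ar2_variance; field; rewrite d1 d2 d3.
Qed.

Let c_le1 : `|b / (1 + a)| <= 1.
Proof.
have a10 : 0 < 1 + a by exact: le_lt_trans ba.
by rewrite normrM normfV (gtr0_norm a10) ler_pdivrMr// mul1r ltW.
Qed.

(** For [|c| <= 1], the form [z ^+ 2 + 2 * z * y * c + y ^+ 2] is half of [(1 + c) * (z + y) ^+ 2 +
    (1 - c) * (z - y) ^+ 2]; exchanging the weights gives its gap to [2 * z ^+ 2 + 2 * y ^+ 2]. *)
Let V_bounds k : 0 <= V k <= (1 + 2 * C * a ^+ 2) * p k ^+ 2 + 2 * C * p k.+1 ^+ 2.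
Proof.
rewrite /V; move: c_le1; set c := b / (1 + a); rewrite ler_norml => /andP[c1 c2].
set x := p k; set y := p k.+1; have C0 := ltW ar2_variance_gt0.
have form : 0 <= (a * x) ^+ 2 + 2 * (a * x) * y * c + y ^+ 2
    <= 2 * (a * x) ^+ 2 + 2 * y ^+ 2.
  set z := a * x.
  have c1' : 0 <= 1 + c by lra.
  have c2' : 0 <= 1 - c by lra.
  have := mulr_ge0 c1' (sqr_ge0 (z + y)).
  have := mulr_ge0 c2' (sqr_ge0 (z - y)).
  have := mulr_ge0 c1' (sqr_ge0 (z - y)).
  have := mulr_ge0 c2' (sqr_ge0 (z + y)).
  by move=> h1 h2 h3 h4; apply/andP; split; lra.
have /andP[f1 f2] := form; apply/andP; split.
  by rewrite addr_ge0 ?sqr_ge0// mulr_ge0.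
have := ler_wpM2l C0 f2; lra.
Qed.

(** [V] is nonnegative, so [C] bounds the partial sums, the series converges and its terms
    vanish. *)
Lemma ar2_sqr_cvg0 : (fun k => p k ^+ 2) @ \oo --> (0 : R).
Proof.
apply: cvg_series_cvg_0; apply: nondecreasing_is_cvgn.
  by apply/nondecreasing_seqP => k; rewrite seriesSr lerDl sqr_ge0.
exists C => _ [k _ <-]; rewrite seriesEord/= sumV gerBl.
by have /andP[] := V_bounds k.
Qed.

Lemma ar2_sum_cvg : (fun k => \sum_(j < k) p j ^+ 2) @ \oo --> C.
Proof.
have -> : (fun k => \sum_(j < k) p j ^+ 2) = (fun k => C - V k).
  by apply/funext => k; exact: sumV.
rewrite -[X in _ --> X]subr0; apply: cvgB; first exact: cvg_cst.
apply: (@squeeze_cvgr _ _ _ _ (fun=> 0)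
  (fun k => (1 + 2 * C * a ^+ 2) * p k ^+ 2 + 2 * C * p k.+1 ^+ 2)).
- by near=> k; exact: V_bounds.
- exact: cvg_cst.
- have e : (1 + 2 * C * a ^+ 2) * 0 + 2 * C * 0 = 0 :> R by rewrite !mulr0 addr0.
  rewrite -[X in _ --> X]e; apply: cvgD; apply: cvgM; try exact: cvg_cst.
    exact: ar2_sqr_cvg0.
  by rewrite (cvg_shiftS (fun k => p k ^+ 2)); exact: ar2_sqr_cvg0.
Unshelve. all: by end_near. Qed.

End Ar2.

(** * Real matrices diagonalized by one complex basis *)

Section Diagonal.
Variables (R : realType) (n : nat) (U : 'M[R[i]]_n).
Hypothesis Uunit : U \in unitmx.
Implicit Types (A B : 'M[R]_n) (f g : 'I_n -> R).

(** [U] is complex because the spectral theorem is applied over [R[i]], while [f] keeps the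
    eigenvalues real. With [U] shared, sums and products of matrices act entrywise on [f]. *)
Definition diagonal_in f A :=
  map_mx (real_complex R) A =
    invmx U *m diag_mx (\row_i real_complex R (f i)) *m U.

Lemma diagonal_in_scalar (c : R) : diagonal_in (fun=> c) c%:M.
Proof.
rewrite /diagonal_in map_scalar_mx.
have -> : diag_mx (\row_(i < n) real_complex R c) = (real_complex R c)%:M.
  by apply/matrixP => i j; rewrite !mxE.
by rewrite mul_mx_scalar -scalemxAl mulVmx// scalemx1.
Qed.

Lemma diagonal_inD f g A B : diagonal_in f A -> diagonal_in g B ->
  diagonal_in (fun i => f i + g i) (A + B).
Proof.
rewrite /diagonal_in map_mxD => -> ->; rewrite -mulmxDl -mulmxDr.
congr (_ *m _ *m _); apply/matrixP => i j; rewrite !mxE.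
by rewrite rmorphD mulrnDl.
Qed.

Lemma diagonal_inM f g A B : diagonal_in f A -> diagonal_in g B ->
  diagonal_in (fun i => f i * g i) (A *m B).
Proof.
rewrite /diagonal_in map_mxM => -> ->.
rewrite !mulmxA (mulmxK Uunit) -[in LHS](mulmxA (invmx U)) mulmx_diag.
by congr (_ *m diag_mx _ *m _); apply/rowP => i; rewrite !mxE rmorphM.
Qed.

Lemma diagonal_inZ c f A : diagonal_in f A ->
  diagonal_in (fun i => c * f i) (c *: A).
Proof.
by move=> fA; rewrite -mul_scalar_mx; apply: diagonal_inM => //;
  exact: diagonal_in_scalar.
Qed.

Lemma diagonal_inB f g A B : diagonal_in f A -> diagonal_in g B ->
  diagonal_in (fun i => f i - g i) (A - B).
Proof.
move=> fA gB; rewrite -scaleN1r.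
have := diagonal_inD fA (diagonal_inZ (-1) gB).
by rewrite /diagonal_in => ->; congr (_ *m diag_mx _ *m _);
  apply/rowP => i; rewrite !mxE mulN1r.
Qed.

Lemma diagonal_in_impulse f g A B t : diagonal_in f A -> diagonal_in g B ->
  diagonal_in (fun i => impulse (f i) (g i) t) (impulse A B t).
Proof.
move=> fA gB; suff: diagonal_in (fun i => impulse (f i) (g i) t) (impulse A B t) /\
  diagonal_in (fun i => impulse (f i) (g i) t.+1) (impulse A B t.+1) by case.
elim: t => [|t [IH0 IH1]].
  split; last exact: diagonal_in_scalar.
  by have := diagonal_in_scalar 0; rewrite raddf0.
split; first exact: IH1.
exact (diagonal_inD (diagonal_inM fA IH1) (diagonal_inM gB IH0)).
Qed.

Lemma diagonal_in_trace f A : diagonal_in f A -> \tr A = \sum_i f i.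
Proof.
move=> fA; apply: (fmorph_inj (real_complex R)).
rewrite -trace_map_mx fA mxtrace_mulC mulmxA mulmxV// mul1mx mxtrace_diag.
by rewrite rmorph_sum; apply: eq_bigr => i _; rewrite mxE.
Qed.

End Diagonal.

Lemma symmetric_diagonal (R : realType) (n : nat) (Q : 'M[R]_n) : Q^T = Q ->
  exists (U : 'M[R[i]]_n) (lam : 'I_n -> R),
    [/\ U \in unitmx, diagonal_in U lam Q & forall i, eigenvalue Q (lam i)].
Proof.
move=> Qsym; pose Qc := map_mx (real_complex R) Q.
have Qreal : Qc \is a realmx.
  by apply/mxOverP => i j; rewrite mxE complex_real.
have Qcsym : Qc \is symmetricmx.
  apply/is_hermitianmxP; rewrite expr0 scale1r map_mx_id//.
  by rewrite /Qc map_trmx Qsym.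
have Qherm := realsym_hermsym Qcsym Qreal.
have /orthomx_spectralP QE := hermitian_normalmx Qherm.
have Dreal := hermitian_spectral_diag_real Qherm.
have Uunit := spectral_unit Qc.
set U := spectralmx Qc in QE Uunit; set D := spectral_diag Qc in QE Dreal.
pose lam i := complex.Re (D 0 i).
have DE : D = \row_i real_complex R (lam i).
  by apply/rowP => i; rewrite mxE RRe_real//; move/mxOverP: Dreal; apply.
exists U, lam; split.
- exact: Uunit.
- by rewrite /diagonal_in -DE; exact: QE.
(* The eigenvector, a row of [U], is complex; the characteristic polynomial carries the eigenvalue
   back to [R]. *)
move=> i; rewrite eigenvalue_root_char -(fmorph_root (real_complex R)).
rewrite map_char_poly -eigenvalue_root_char; apply/eigenvalueP.
exists (row i U); last first.
  apply/negP => /eqP Ui0; have := mulmxV Uunit => /(congr1 (row i)).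
  rewrite row_mul Ui0 mul0mx => /rowP/(_ i)/eqP.
  by rewrite !mxE eqxx eq_sym oner_eq0.
rewrite -row_mul -/Qc {1}QE !mulmxA mulmxV// mul1mx DE row_mul row_diag_mx.
by rewrite -scalemxAl -rowE mxE.
Qed.

(** * Symmetry of the matrix impulse response *)

Section Impulse.
Variables (R : realType) (n : nat).
Implicit Types A B : 'M[R]_n.

Lemma impulse_comm A B X t : comm_mx X A -> comm_mx X B ->
  comm_mx X (impulse A B t).
Proof.
move=> XA XB; suff: comm_mx X (impulse A B t) /\ comm_mx X (impulse A B t.+1) by case.
elim: t => [|t [IH0 IH1]]; first by split; [exact: comm_mx0|exact: comm_mx1].
split; first exact: IH1.
by rewrite impulseSS; apply: comm_mxD; apply: comm_mxM.
Qed.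

(** Transposing reverses products, and commutation restores their order. Symmetry turns the
    Frobenius norm into a trace. *)
Lemma impulse_sym A B t : A^T = A -> B^T = B -> comm_mx A B ->
  (impulse A B t)^T = impulse A B t.
Proof.
move=> As Bs AB; suff: (impulse A B t)^T = impulse A B t /\
  (impulse A B t.+1)^T = impulse A B t.+1 by case.
elim: t => [|t [IH0 IH1]]; first by rewrite /= trmx0 trmx1.
split; first exact: IH1.
rewrite impulseSS linearD/= !trmx_mul IH0 IH1 As Bs.
congr (_ + _).
  exact (esym (impulse_comm t.+1 (comm_mx_refl A) AB)).
exact (esym (impulse_comm t (comm_mx_sym AB) (comm_mx_refl B))).
Qed.

End Impulse.

Lemma frobenius_trace (R : realType) (n : nat) (A : 'M[R]_n) : A^T = A ->
  \sum_i \sum_j A i j ^+ 2 = \tr (A *m A).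
Proof.
move=> As; apply: eq_bigr => i _; rewrite mxE; apply: eq_bigr => j _.
by rewrite -{3}As mxE expr2.
Qed.

(** A left eigenvector [v] of [Q] lifts to the left eigenvector [((z + b) v, v)] of [momA] when
    [z ^+ 2 + b * z + a = 0]. *)
Lemma momA_eigenvalue (R : realType) (n : nat) (alpha beta gamma rho lam : R)
    (Q : 'M[R]_n) : eigenvalue Q lam ->
    spectral_radius_le (momA alpha beta gamma Q) rho ->
  forall z : R[i], z ^+ 2
    + real_complex R ((1 + gamma) * alpha * lam - (1 + beta)) * z
    + real_complex R (beta - gamma * alpha * lam) = 0 ->
  `|z| <= real_complex R rho.
Proof.
move=> /eigenvalueP[v vQ v0] radius z z0; apply: radius.
rewrite map_char_poly -eigenvalue_root_char; apply/eigenvalueP.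
pose vc := map_mx (real_complex R) v.
have vcQ : vc *m map_mx (real_complex R) Q = real_complex R lam *: vc.
  by rewrite -map_mxM vQ map_mxZ.
set b := _ - (1 + beta) in z0; set a := beta - _ in z0.
exists (row_mx ((z + real_complex R b) *: vc) vc).
  rewrite /momA map_block_mx mul_row_block raddf0 mulmx0 add0r.
  rewrite !map_mxB !map_mxZ !map_scalar_mx mulmx1.
  rewrite !mulmxBr !mul_mx_scalar -!scalemxAr !vcQ scale_row_mx !scalerA.
  congr row_mx; rewrite -?scalerBl -?scalerDl -?rmorphM -?rmorphB/=; congr (_ *: _).
    have -> : gamma * alpha * lam - beta = - a by rewrite /a opprB.
    by rewrite rmorphN/=; apply/esym/eqP; rewrite -addr_eq0 -z0; apply/eqP; ring.
  have -> : 1 + beta - (1 + gamma) * alpha * lam = - b by rewrite /b opprB.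
  by rewrite rmorphN/= addrK.
apply: contra v0 => /eqP vc0; move/(congr1 rsubmx): vc0; rewrite row_mxKr linear0 => /eqP.
by rewrite map_mx_eq0.
Qed.

(** * Second moments of affine functions of white noise *)

Section Expectation.
Context (d : measure_display) (Omega : measurableType d) (R : realType).
Variable P : probability Omega R.

Lemma expectation_lincomb (K : finType) (f : K -> Omega -> R) (c e : K -> R) :
    (forall k, P.-integrable setT (EFin \o f k)) ->
    (forall k, 'E_P[f k] = (e k)%:E)%E ->
  ('E_P[fun om => (\sum_k c k * f k om)%R] = (\sum_k c k * e k)%:E)%E.
Proof.
move=> intf fe; rewrite unlock.
under eq_integral do rewrite -sumEFin.
rewrite (@integral_sum _ _ _ P setT measurableT _ (fun k om => (c k * f k om)%:E)).
  rewrite -sumEFin; apply: eq_bigr => k _.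
  under eq_integral do rewrite EFinM.
  rewrite (integralZl measurableT (intf k)); have := fe k; rewrite unlock => feE.
  by rewrite [X in (_ * X)%E]feE.
by move=> k; exact: (integrableZl measurableT (c k) (intf k)).
Qed.

(** The product is dominated by [f ^+ 2 + g ^+ 2]. *)
Lemma integrable_mul (f g : Omega -> R) :
    measurable_fun setT f -> measurable_fun setT g ->
    ('E_P[fun om => (f om * f om)%R] < +oo)%E ->
    ('E_P[fun om => (g om * g om)%R] < +oo)%E ->
  P.-integrable setT (EFin \o (fun om => f om * g om)).
Proof.
move=> mf mg ff gg.
have int_sqr (h : Omega -> R) : measurable_fun setT h ->
    ('E_P[fun om => (h om * h om)%R] < +oo)%E ->
    P.-integrable setT (EFin \o (fun om => h om * h om)).
  move=> mh hh; apply/integrableP; split.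
    by apply/measurable_EFinP; exact: measurable_funM.
  apply: le_lt_trans hh; rewrite unlock le_eqVlt; apply/orP; left; apply/eqP.
  by apply: eq_integral => x _ /=; rewrite ger0_norm// -expr2 sqr_ge0.
apply: (le_integrable measurableT _ _
  (integrableD measurableT (int_sqr _ mf ff) (int_sqr _ mg gg))).
  by apply/measurable_EFinP; exact: measurable_funM.
move=> x _ /=; rewrite lee_fin normrM.
rewrite [leRHS]ger0_norm ?addr_ge0 -?expr2 ?sqr_ge0//.
have := sqr_ge0 (`|f x| - `|g x|); have := sqr_ge0 (`|f x| + `|g x|).
rewrite -[f x ^+ 2]real_normK ?num_real// -[g x ^+ 2]real_normK ?num_real//.
lra.
Qed.

Lemma expectation_sqr_orthonormal (I K : finType) (Y : I -> Omega -> R)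
    (G : K -> I -> R) :
    (forall a, measurable_fun setT (Y a)) ->
    (forall a b, 'E_P[fun om => (Y a om * Y b om)%R] = (a == b)%:R%:E)%E ->
  ('E_P[fun om => (\sum_k (\sum_a G k a * Y a om) ^+ 2)%R]
     = (\sum_k \sum_a G k a ^+ 2)%:E)%E.
Proof.
move=> mY EY.
(* Gram coefficients of the expanded squares; orthonormality keeps only their diagonal. *)
pose c (ab : I * I) := \sum_k G k ab.1 * G k ab.2.
have -> : (fun om => \sum_k (\sum_a G k a * Y a om) ^+ 2) =
    (fun om => \sum_ab c ab * (Y ab.1 om * Y ab.2 om)).
  apply/funext => om; under [RHS]eq_bigr do rewrite /c mulr_suml.
  rewrite [RHS]exchange_big; apply: eq_bigr => k _.
  rewrite expr2 mulr_suml.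
  rewrite -(pair_bigA _ (fun a b => G k a * G k b * (Y a om * Y b om)))/=.
  apply: eq_bigr => a _; rewrite mulr_sumr; apply: eq_bigr => b _; ring.
rewrite (@expectation_lincomb _ (fun ab om => Y ab.1 om * Y ab.2 om) c
  (fun ab => (ab.1 == ab.2)%:R)).
- congr EFin; rewrite -(pair_bigA _ (fun a b => c (a, b) * (a == b)%:R))/=.
  rewrite [RHS]exchange_big/=; apply: eq_bigr => a _.
  rewrite (bigD1 a)//= eqxx mulr1 big1 ?addr0; last first.
    by move=> b ba; rewrite eq_sym (negbTE ba) mulr0.
  by apply: eq_bigr => k _; rewrite expr2.
- by move=> [a b]; apply: integrable_mul; rewrite ?EY ?ltry//; exact: mY.
- by move=> [a b]; exact: EY.
Qed.

Lemma expectation_sqr_affine (I K : finType) (Z : I -> {RV P >-> R})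
    (c : K -> R) (F : K -> I -> R) :
    (forall a, 'E_P[Z a] = 0)%E ->
    (forall a b, 'E_P[fun om => (Z a om * Z b om)%R] = (a == b)%:R%:E)%E ->
  ('E_P[fun om => (\sum_k (c k + \sum_a F k a * Z a om) ^+ 2)%R]
     = (\sum_k c k ^+ 2 + \sum_k \sum_a F k a ^+ 2)%:E)%E.
Proof.
move=> EZ EZZ.
(* Centered [Z] are orthogonal to the constant 1, which joins the family at index [None] and carries
   the offset [c]. *)
pose Y (a : option I) (om : Omega) : R := if a is Some a' then Z a' om else 1.
pose G k (a : option I) : R := if a is Some a' then F k a' else c k.
have sum_option (h : option I -> R) : \sum_a h a = h None + \sum_a h (Some a).
  rewrite (bigD1 None)//=; congr (_ + _).
  rewrite (reindex_omap (Some : I -> option I) id)/=; last by case.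
  by apply: eq_bigl => a; rewrite eqxx.
have -> : (fun om => \sum_k (c k + \sum_a F k a * Z a om) ^+ 2) =
    (fun om => \sum_k (\sum_a G k a * Y a om) ^+ 2).
  apply/funext => om; apply: eq_bigr => k _.
  by rewrite sum_option/= mulr1.
rewrite expectation_sqr_orthonormal.
- congr EFin; rewrite -big_split/=; apply: eq_bigr => k _.
  by rewrite sum_option.
- by case=> [a|]; [exact: measurable_funPT|exact: measurable_cst].
- case=> [a|] [b|]/=.
  + exact: EZZ.
  + by rewrite -[RHS](EZ a); congr expectation; apply/funext => x; rewrite mulr1.
  + by rewrite -[RHS](EZ b); congr expectation; apply/funext => x; rewrite mul1r.
  + rewrite -(expectation_cst P 1); congr expectation.
    by apply/funext => x; rewrite mulr1.
Qed.

End Expectation.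

(** * Error dynamics and their explicit solution *)

Section Dynamics.
Variables (R : realType) (n : nat).
Implicit Types (Q M N : 'M[R]_n) (q x : 'cV[R]_n).

Lemma sqnorm_eq0 x : sqnorm x = 0 -> x = 0.
Proof.
move=> x0; apply/colP => i; rewrite mxE; apply/eqP; rewrite -sqrf_eq0.
have /psumr_eq0P -> // := x0; by move=> j _; exact: sqr_ge0.
Qed.

Lemma minimizer_gradient0 Q q xs : Q^T = Q -> posdef Q -> is_minimizer Q q xs ->
  Q *m xs = q.
Proof.
move=> Qs Qpos xmin; apply/eqP; rewrite -subr_eq0; apply/negP => /negP g0.
have [g gdef] : exists g, g = Q *m xs - q by eexists.
rewrite -gdef in g0.
have k0 := Qpos _ g0; set k := (g^T *m Q *m g) 0 0 in k0.
pose dot (u v : 'cV[R]_n) := (u^T *m v) 0 0.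
have dotC u v : dot u v = dot v u.
  by rewrite /dot -[u^T *m v]trmxK trmx_mul trmxK mxE.
have dotD u v w : dot u (v + w) = dot u v + dot u w by rewrite /dot mulmxDr mxE.
have dotZ u c v : dot u (c *: v) = c * dot u v by rewrite /dot -scalemxAr mxE.
have dotDl u v w : dot (u + v) w = dot u w + dot v w.
  by rewrite dotC dotD !(dotC w).
have dotZl c u v : dot (c *: u) v = c * dot u v by rewrite dotC dotZ (dotC v).
have quadE v : quadf Q q v = 2^-1 * dot v (Q *m v) - dot q v.
  by rewrite /quadf /dot mulmxA.
have dotQ u v : dot u (Q *m v) = dot v (Q *m u).
  by rewrite dotC /dot trmx_mul Qs mulmxA.
have gE : dot g g = sqnorm g.
  by rewrite /dot mxE; apply: eq_bigr => i _; rewrite !mxE expr2.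
set s := sqnorm g in gE.
have kE : dot g (Q *m g) = k by rewrite /dot mulmxA.
(* Exact line search: a step [tau] along [- g] changes the objective by
   [- tau * s + tau ^+ 2 * k / 2], smallest at [tau = s / k]. *)
have := xmin (xs + (- (s / k)) *: g).
rewrite !quadE mulmxDr -scalemxAr !(dotD, dotZ, dotDl, dotZl) kE (dotQ xs g).
have sE : s = dot g (Q *m xs) - dot q g.
  rewrite -gE {2}gdef dotD; congr (_ + _).
  by rewrite (dotC q) -[- q]scaleN1r dotZ mulN1r.
set A := dot xs _; set B := dot q xs; set D := dot g (Q *m xs) in sE *.
set E := dot q g in sE *.
have sk : s / k * k = s by rewrite mulfVK// gt_eqF.
move=> h; have : s * (s / k) <= 0.
  have -> : s * (s / k) = 2 * ((s / k) * s) - (s / k) * (s / k * k).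
    by rewrite sk; ring.
  rewrite {2}sE; lra.
rewrite mulrA pmulr_lle0 ?invr_gt0// -expr2 => s2.
have : s = 0 by apply/eqP; rewrite -sqrf_eq0 eq_le s2 sqr_ge0.
by move/sqnorm_eq0 => gz; rewrite gz eqxx in g0.
Qed.

Definition mom_M (alpha beta gamma : R) Q : 'M[R]_n :=
  gamma * alpha *: Q - beta%:M.
Definition mom_N (alpha beta gamma : R) Q : 'M[R]_n :=
  (1 + beta)%:M - (1 + gamma) * alpha *: Q.

Lemma mom_iter_err alpha beta gamma sw Q q xs x0 x1 (wv : nat -> 'cV[R]_n) t :
  Q *m xs = q ->
  let e k := mom_iter alpha beta gamma sw Q q x0 x1 wv k - xs in
  e t.+2 = mom_N alpha beta gamma Q *m e t.+1
    + mom_M alpha beta gamma Q *m e t + sw *: wv t.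
Proof.
move=> Qxs; rewrite /mom_iter/= /mom_step /quadgrad -Qxs /mom_N /mom_M.
case: (mom_pair _ _ _ _ _ _ _ _ _ _) => u v /=.
rewrite addrAC; congr (_ + _).
rewrite !mulmxBl !mul_scalar_mx -!scalemxAl !mulmxBr !mulmxDr -!scalemxAr !mulmxBr.
by apply/colP => i; rewrite !mxE; ring.
Qed.

(** The noiseless error. Time 0 is separate because [H_t e1 + H_{t-1} M e0] has no index [t - 1]
    there. *)
Definition free_response M N (e0 e1 : 'cV[R]_n) (t : nat) : 'cV[R]_n :=
  if t is s.+1 then impulse N M s.+1 *m e1 + impulse N M s *m (M *m e0) else e0.

Lemma free_responseSS M N e0 e1 t : free_response M N e0 e1 t.+2 =
  N *m free_response M N e0 e1 t.+1 + M *m free_response M N e0 e1 t.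
Proof.
case: t => [|t]; rewrite /free_response !impulseSS.
  by rewrite !mulr0 mulr1 addr0 mul1mx mul0mx addr0 mul1mx.
rewrite !mulmxDl !mulmxDr !mulmxA -!mulmxE !addrA; congr (_ + _).
by rewrite addrAC mulmxDr mulmxDl !mulmxA.
Qed.

Lemma linear_recurrence M N (e w : nat -> 'cV[R]_n) t :
    (forall t, e t.+2 = N *m e t.+1 + M *m e t + w t) ->
  e t = free_response M N (e 0%N) (e 1%N) t
    + \sum_(j < t) impulse N M (t - j).-1 *m w j.
Proof.
move=> rec; pose s t := \sum_(j < t) impulse N M (t - j).-1 *m w j.
(* The newest noise term is multiplied by [H_0 = 0]: [w k] first reaches the error at time
   [k.+2]. *)
have sS k : s k.+1 = \sum_(j < k) impulse N M (k - j) *m w j.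
  rewrite /s big_ord_recr/= subSnn/= mul0mx addr0.
  by apply: eq_bigr => j _; rewrite subSn ?(ltnW (ltn_ord j)).
have sSS k : s k.+2 = N *m s k.+1 + M *m s k + w k.
  rewrite !sS big_ord_recr/= subSnn/= mul1mx; congr (_ + _).
  rewrite /s !mulmx_sumr -big_split/=; apply: eq_bigr => j _.
  have jk := ltn_ord j; rewrite subSn ?(ltnW jk)// -(subnSK jk) /=.
  by rewrite mulmxDl !mulmxA.
rewrite -/(s t); suff: e t = free_response M N (e 0%N) (e 1%N) t + s t /\
  e t.+1 = free_response M N (e 0%N) (e 1%N) t.+1 + s t.+1 by case.
elim: t => [|t [IH0 IH1]].
  rewrite /= sS /s !big_ord0 addr0; split => //.
  by rewrite mul1mx mul0mx !addr0.
split; first exact: IH1.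
by rewrite rec IH0 IH1 free_responseSS sSS !mulmxDr !addrA; congr (_ + _ + _);
  rewrite addrAC.
Qed.

Lemma free_response_cvg0 M N e0 e1 :
    (forall i j, (fun t => impulse N M t i j) @ \oo --> (0 : R)) ->
  (fun t => sqnorm (free_response M N e0 e1 t)) @ \oo --> (0 : R).
Proof.
move=> H0; rewrite -(cvg_shiftS (fun t => sqnorm (free_response M N e0 e1 t))).
have mulv0 (v : 'cV[R]_n) i : (fun t => (impulse N M t *m v) i 0) @ \oo --> (0 : R).
  rewrite (_ : (fun t => _) = (fun t => \sum_j impulse N M t i j * v j 0));
    last by apply/funext => t; rewrite mxE.
  apply: cvg_ord_sum0 => j; rewrite -[X in _ --> X](mul0r (v j 0)).
  by apply: cvgM; [exact: H0|exact: cvg_cst].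
apply: cvg_ord_sum0 => i.
have ei : (fun t => free_response M N e0 e1 t.+1 i 0) @ \oo --> (0 : R).
  rewrite (_ : (fun t => _) = (fun t => (impulse N M t.+1 *m e1) i 0
      + (impulse N M t *m (M *m e0)) i 0)); last by apply/funext => t; rewrite mxE.
  rewrite -[X in _ --> X]addr0; apply: cvgD; last exact: mulv0.
  by rewrite (cvg_shiftS (fun t => (impulse N M t *m e1) i 0)); exact: mulv0.
by rewrite -[X in _ --> X](mul0r (0 : R)); exact: (cvgM ei ei).
Qed.

End Dynamics.

(** * Bounds from the spectral radius *)

Section Spectrum.
Variables (R : realType) (n : nat) (alpha beta gamma rho : R) (Q : 'M[R]_n).
Hypotheses (hrho : 0 < rho < 1) (Qs : Q^T = Q).
Hypothesis radius : spectral_radius_le (momA alpha beta gamma Q) rho.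

Let a lam := beta - gamma * alpha * lam.
Let b lam := (1 + gamma) * alpha * lam - (1 + beta).
Let H := impulse (mom_N alpha beta gamma Q) (mom_M alpha beta gamma Q).
Let frob t := \sum_i \sum_j H t i j ^+ 2.

Lemma eigenvalue_disk lam : eigenvalue Q lam ->
  [/\ - rho ^+ 2 <= a lam, a lam <= rho ^+ 2
     & `|b lam| * rho <= rho ^+ 2 + a lam].
Proof.
move=> Ql; have /andP[rho0 _] := hrho.
by apply: quadratic_roots_disk => //; exact: momA_eigenvalue Ql radius.
Qed.

(** [alpha * lam] is the characteristic polynomial at 1. The Jury condition makes it positive, so
    its upper bound survives squaring. *)
Lemma step_size_bound lam : 0 < lam -> eigenvalue Q lam ->
  alpha ^+ 2 <= (1 + rho) ^+ 4 / lam ^+ 2.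
Proof.
move=> lam0 /eigenvalue_disk hab; have [_ b1] := disk_jury hrho hab.
have [al au hb] := hab; have /andP[r0 r1] := hrho.
have abE : alpha * lam = 1 + a lam + b lam by rewrite /a /b; ring.
have b2 : `|b lam| <= 2 * rho.
  by rewrite -(ler_pM2r r0); apply: (le_trans hb); lra.
have b3 := ler_norm (b lam).
rewrite ler_pdivlMr ?exprn_gt0// -exprMn abE.
have -> : (1 + rho) ^+ 4 = ((1 + rho) ^+ 2) ^+ 2 by ring.
rewrite ler_sqr ?nnegrE ?sqr_ge0//; first lra.
by move: b1; rewrite ltr_norml => /andP[? _]; lra.
Qed.

(** The response is symmetric and diagonal in the eigenbasis of [Q], so [frob t] sums the squared
    scalar responses, and [S] is the sum of their variances. *)
Lemma impulse_frobenius_series : exists S,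
  [/\ (fun k => \sum_(t < k) frob t) @ \oo --> S,
      S <= n%:R * ((1 + rho ^+ 2) / (1 - rho ^+ 2) ^+ 3)
    & forall i j, (fun t => H t i j) @ \oo --> (0 : R)].
Proof.
have [U [lam [Uu Qdiag Qeig]]] := symmetric_diagonal Qs.
pose p i := impulse (- b (lam i)) (- a (lam i)).
have Hdiag t : diagonal_in U (fun i => p i t) (H t).
  have Ndiag : diagonal_in U (fun i => - b (lam i)) (mom_N alpha beta gamma Q).
    have := diagonal_inB Uu (diagonal_in_scalar Uu (1 + beta))
      (diagonal_inZ Uu ((1 + gamma) * alpha) Qdiag).
    by rewrite /diagonal_in => ->; congr (_ *m diag_mx _ *m _);
      apply/rowP => i; rewrite !mxE /b opprB.
  have Mdiag : diagonal_in U (fun i => - a (lam i)) (mom_M alpha beta gamma Q).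
    have := diagonal_inB Uu (diagonal_inZ Uu (gamma * alpha) Qdiag)
      (diagonal_in_scalar Uu beta).
    by rewrite /diagonal_in => ->; congr (_ *m diag_mx _ *m _);
      apply/rowP => i; rewrite !mxE /a opprB.
  exact: diagonal_in_impulse.
have Hsym t : (H t)^T = H t.
  apply: impulse_sym.
  - by rewrite /mom_N linearB/= linearZ/= tr_scalar_mx Qs.
  - by rewrite /mom_M linearB/= linearZ/= tr_scalar_mx Qs.
  - rewrite /comm_mx /mom_N /mom_M !mulmxBl !mulmxBr !mul_scalar_mx !mul_mx_scalar.
    rewrite -!scalemxAl -!scalemxAr; apply/matrixP => i j; rewrite !mxE; ring.
have frobE t : frob t = \sum_i p i t ^+ 2.
  rewrite /frob frobenius_trace// (diagonal_in_trace Uu (diagonal_inM Uu (Hdiag t) (Hdiag t))).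
  by apply: eq_bigr => i _; rewrite expr2.
have jury i : `|a (lam i)| < 1 /\ `|b (lam i)| < 1 + a (lam i).
  exact: disk_jury hrho (eigenvalue_disk (Qeig i)).
exists (\sum_i ar2_variance (a (lam i)) (b (lam i))); split.
- have -> : (fun k => \sum_(t < k) frob t) =
      (fun k => \sum_i \sum_(t < k) p i t ^+ 2).
    by apply/funext => k; under eq_bigr do rewrite frobE; exact: exchange_big.
  by apply: cvg_ord_sum => i; have [? ?] := jury i; exact: ar2_sum_cvg.
- rewrite mulr_natl -[X in _ *+ X]card_ord -sumr_const; apply: ler_sum => i _.
  exact: ar2_variance_le hrho (eigenvalue_disk (Qeig i)).
(* Each squared entry is one term of [frob t], which tends to 0. *)
- move=> i j; apply: sqr_cvg0.
  apply: (@squeeze_cvgr _ _ _ _ (fun=> 0) frob).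
  + near=> t; rewrite sqr_ge0/= /frob (bigD1 i)//= (bigD1 j)//= -addrA lerDl.
    by rewrite addr_ge0 ?sumr_ge0// => k _; rewrite ?sumr_ge0// => *; exact: sqr_ge0.
  + exact: cvg_cst.
  + rewrite (_ : frob = (fun t => \sum_i p i t ^+ 2)); last exact/funext.
    by apply: cvg_ord_sum0 => l; have [? ?] := jury l; exact: ar2_sqr_cvg0.
Unshelve. all: by end_near. Qed.

End Spectrum.

(** Each error coordinate is affine in the noise coordinates, indexed by pairs of time and
    component, which are centered and orthonormal. *)
Lemma mean_sq_errE (R : realType) (n : nat) (alpha beta gamma : R)
    (d : measure_display) (Omega : measurableType d) (P : probability Omega R)
    (w : nat -> 'I_n -> {RV P >-> R}) (sw : R) (Q : 'M[R]_n)
    (q xs x0 x1 : 'cV[R]_n) (k : nat) :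
    white_noise w -> Q *m xs = q ->
  let M := mom_M alpha beta gamma Q in
  let N := mom_N alpha beta gamma Q in
  mean_sq_err w alpha beta gamma sw Q q x0 x1 xs k =
  (sqnorm (free_response M N (x0 - xs) (x1 - xs) k)
    + sw ^+ 2 * \sum_(t < k) \sum_i \sum_j impulse N M t i j ^+ 2)%:E.
Proof.
move=> [Ew Eww] Qxs M N; set u := free_response _ _ _ _ _.
pose Z (a : 'I_k * 'I_n) := w a.1 a.2.
pose F (i : 'I_n) (a : 'I_k * 'I_n) := sw * impulse N M (k - a.1).-1 i a.2.
rewrite /mean_sq_err.
have -> : (fun om => sqnorm (mom_iter alpha beta gamma sw Q q x0 x1
      (noise_vec w om) k - xs)) =
    (fun om => \sum_i (u i 0 + \sum_a F i a * Z a om) ^+ 2).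
  apply/funext => om; apply: eq_bigr => i _; congr (_ ^+ 2).
  pose e t := mom_iter alpha beta gamma sw Q q x0 x1 (noise_vec w om) t - xs.
  have := @linear_recurrence _ _ M N e (fun t => sw *: noise_vec w om t) k.
  rewrite -/(e k) => ->; last by move=> t; exact: mom_iter_err.
  rewrite mxE summxE; congr (_ + _).
  rewrite -(pair_bigA _ (fun a b => F i (a, b) * Z (a, b) om))/=.
  apply: eq_bigr => j _; rewrite mxE; apply: eq_bigr => l _.
  by rewrite /F /Z /noise_vec !mxE/=; ring.
rewrite (@expectation_sqr_affine _ _ _ P _ _ Z (fun i => u i 0) F).
- congr (_ + _)%:E.
  transitivity (\sum_i \sum_(j < k) \sum_l F i (j, l) ^+ 2).
    by apply: eq_bigr => i _; rewrite pair_bigA; apply: eq_bigr => -[].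
  (* Reversing time turns the delay [(k - j).-1] into the summation index. *)
  rewrite exchange_big mulr_sumr [RHS](reindex_inj rev_ord_inj)/=.
  apply: eq_bigr => j _.
  rewrite mulr_sumr; apply: eq_bigr => i _.
  rewrite mulr_sumr; apply: eq_bigr => l _.
  by rewrite /F exprMn/= subnS.
- by move=> [j l]; exact: Ew.
- move=> [j l] [j' l']; rewrite /Z/= Eww.
  by rewrite -[(j, l) == _]/((j == j') && (l == l')); case: ifP.
Qed.

Theorem theorem1 (R : realType) (n : nat) (hn : (0 < n)%N) (m L : R)
  (hm : 0 < m) (hmL : m <= L) (alpha beta gamma rho : R)
  (hrho : 0 < rho < 1)
  (hconv : converges_linearly n m L alpha beta gamma rho)
  (d : measure_display) (Omega : measurableType d) (P : probability Omega R)
  (w : nat -> 'I_n -> {RV P >-> R}) (hw : white_noise w)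
  (sw : R) (Q : 'M[R]_n) (q : 'cV[R]_n) (hQ : in_QmL m L Q)
  (xs : 'cV[R]_n) (hxs : is_minimizer Q q xs) (x0 x1 : 'cV[R]_n) :
  let Ts := (1 - rho)^-1 in
  exists J : R,
    cesaro_msq w alpha beta gamma sw Q q x0 x1 xs @ \oo --> J%:E /\
    J <= sw ^+ 2 * (1 + rho ^+ 2) / (1 + rho) ^+ 3 * n%:R * Ts ^+ 3 /\
    (forall sigma : R, 0 < sigma -> sw = alpha * sigma ->
       J <= sigma ^+ 2 * (1 + rho) * (1 + rho ^+ 2) / L ^+ 2 * n%:R * Ts ^+ 3).
Proof.
have radius := hconv Q hQ; have [Qs Qpos QL _ _] := hQ.
have Qxs := minimizer_gradient0 Qs Qpos hxs.
have [S [Scvg Sle Hcvg]] := impulse_frobenius_series hrho Qs radius.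
have /andP[r0 r1] := hrho.
have d1 : 1 - rho != 0 by rewrite gt_eqF//; lra.
have d2 : 1 + rho != 0 by rewrite gt_eqF//; lra.
have L0 : 0 < L by exact: lt_le_trans hmL.
move=> Ts.
have bound1 :
    sw ^+ 2 * S <= sw ^+ 2 * (1 + rho ^+ 2) / (1 + rho) ^+ 3 * n%:R * Ts ^+ 3.
  apply: le_trans (ler_wpM2l (sqr_ge0 sw) Sle) _.
  rewrite le_eqVlt; apply/orP; left; apply/eqP.
  have -> : 1 - rho ^+ 2 = (1 - rho) * (1 + rho) by ring.
  by rewrite /Ts; field; rewrite d1 d2.
(* The mean square error itself converges: the free response dies out and the noise part tends to
   this value, which the Cesaro mean inherits. *)
exists (sw ^+ 2 * S); split; [|split] => //.
- pose r k := sqnorm (free_response (mom_M alpha beta gamma Q)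
      (mom_N alpha beta gamma Q) (x0 - xs) (x1 - xs) k)
    + sw ^+ 2 * \sum_(t < k) \sum_i \sum_j impulse (mom_N alpha beta gamma Q)
        (mom_M alpha beta gamma Q) t i j ^+ 2.
  have -> : cesaro_msq w alpha beta gamma sw Q q x0 x1 xs =
      EFin \o (fun t => t%:R^-1 * \sum_(k < t.+1) r k).
    apply/funext => t; rewrite /cesaro_msq /= EFinM -sumEFin.
    by congr (_ * _)%E; apply: eq_bigr => k _; exact: mean_sq_errE.
  apply: cvg_EFin; first by near=> t.
  apply: cesaro_shift; rewrite -[X in _ --> X]add0r; apply: cvgD.
    exact: free_response_cvg0.
  by apply: cvgM; [exact: cvg_cst|exact: Scvg].
- move=> sigma sigma0 swE; apply: (le_trans bound1).
  have -> : sw ^+ 2 * (1 + rho ^+ 2) / (1 + rho) ^+ 3 * n%:R * Ts ^+ 3 =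
      alpha ^+ 2 * (sigma ^+ 2 * (1 + rho ^+ 2) / (1 + rho) ^+ 3 * n%:R * Ts ^+ 3).
    by rewrite swE; ring.
  (* The step size bound contributes [(1 + rho) ^+ 4], which against the denominator
     [(1 + rho) ^+ 3] leaves [1 + rho]. *)
  have -> : sigma ^+ 2 * (1 + rho) * (1 + rho ^+ 2) / L ^+ 2 * n%:R * Ts ^+ 3 =
      (1 + rho) ^+ 4 / L ^+ 2 *
        (sigma ^+ 2 * (1 + rho ^+ 2) / (1 + rho) ^+ 3 * n%:R * Ts ^+ 3).
    by rewrite /Ts; field; rewrite d1 d2 gt_eqF.
  apply: ler_wpM2r; last exact: step_size_bound radius _ L0 QL.
  apply: mulr_ge0; last by rewrite exprn_ge0// invr_ge0 subr_ge0 ltW.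
  apply: mulr_ge0 => //; apply: divr_ge0.
    by rewrite mulr_ge0 ?addr_ge0 ?sqr_ge0.
  by rewrite exprn_ge0// addr_ge0// ltW.
Unshelve. all: by end_near. Qed.
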